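(* Let $\Omega=[a,b]^\nu\subset\mathbb{R}^\nu$, let $k\in C(\Omega^3)$, let $T_1$ be the partial integral operator on $L_2(\Omega\times\Omega)$ given by $(T_1f)(x,y)=\int_\Omega k(x,s,y)f(s,y)\,ds$, and let $T_1^*$ be its adjoint, which is the partial integral operator with kernel $\overline{k(s,x,y)}$. Let $\varkappa_0\in\mathbb{C}$. (a) If $\varkappa_0\in\mathcal{E}_{T_1}$, then $\overline{\varkappa_0}\in\mathcal{E}_{T_1^*}$. (b) If $\varkappa_0\in\mathcal{X}_{T_1}$, then $\overline{\varkappa_0}\in\mathcal{X}_{T_1^*}$. Here $\mathcal{E}$ and $\mathcal{X}$ denote the sets of essential and of characteristic numbers, respectively.
   Context: Here $a<b$ are reals, $\nu\ge 1$ is an integer, $\mu$ is Lebesgue measure on $\Omega=[a,b]^\nu$, and all $L_2$ spaces are complex. For a continuous kernel $k\in C(\Omega^3)$ (complex-valued), let $T_1$ be the bounded operator on $L_2(\Omega\times\Omega)$ given by $(T_1f)(x,y)=\int_\Omega k(x,s,y)f(s,y)\,ds$. Its adjoint is $(T_1^*f)(x,y)=\int_\Omega\overline{k(s,x,y)}f(s,y)\,ds$, an operator of the same type with continuous kernel $(x,s,y)\mapsto\overline{k(s,x,y)}$. For an operator $T_1$ of this type with kernel $k$, for $\varkappa\in\mathbb{C}$ and $y\in\Omega$, the determinant is the Fredholm determinant of $E-\varkappa K_y$, where $E$ is the identity on $L_2(\Omega)$ and $(K_y\varphi)(x)=\int_\Omega k(x,s,y)\varphi(s)\,ds$ on $L_2(\Omega)$,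 i.e. $$D_1(y;\varkappa)=1+\sum_{n=1}^\infty\frac{(-\varkappa)^n}{n!}\int_{\Omega^n}\det\big(k(\xi_i,\xi_j,y)\big)_{i,j=1}^n\,d\xi_1\cdots d\xi_n ,$$ which is continuous in $y$ for each $\varkappa$. Definitions (for the equation $f-\varkappa T_1f=g_0$): $\varkappa_0\in\mathbb{C}$ is a singular number if $D_1(y_0;\varkappa_0)=0$ for some $y_0\in\Omega$ (set $\mathcal{S}_{T_1}$); $\varkappa_0$ is a characteristic number if there is a measurable $\Omega_0\subset\Omega$ with $\mu(\Omega_0)>0$ and $D_1(y;\varkappa_0)=0$ for all $y\in\Omega_0$ (set $\mathcal{X}_{T_1}$); $\varkappa_0$ is an essential number if $\varkappa_0\in\mathcal{E}_{T_1}:=\mathcal{S}_{T_1}\setminus\mathcal{X}_{T_1}$. The sets $\mathcal{E}_{T_1^*}$, $\mathcal{X}_{T_1^*}$ are defined in the same way using the kernel $\overline{k(s,x,y)}$ of $T_1^*$. *)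

(* Defs.v *)
From HB Require Import structures.
From mathcomp Require Import all_boot all_order all_algebra.
From mathcomp Require Import all_classical all_reals all_analysis.
From mathcomp Require Import complex.

Set Implicit Arguments.
Unset Strict Implicit.
Unset Printing Implicit Defensive.
Import Order.TTheory GRing.Theory Num.Theory.
Import numFieldNormedType.Exports.
Local Open Scope classical_set_scope.
Local Open Scope ring_scope.
Local Open Scope complex_scope.

Section power_measure_succ.
Local Open Scope ereal_scope.
Context d (T : measurableType d) (R : realType) (n : nat).
Variables (mu : {sigma_finite_measure set T -> \bar R}).
Variables (nu : {sigma_finite_measure set (n.-tuple T) -> \bar R}).

Let consp (p : T * n.-tuple T) : n.+1.-tuple T := [tuple of p.1 :: p.2].

Definition cons_measure : set (n.+1.-tuple T) -> \bar R :=
  pushforward (mu \x nu) consp.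

Let measurable_consp : measurable_fun setT consp.
Proof. exact: measurable_cons. Qed.

Let cons0 : cons_measure set0 = 0.
Proof. by rewrite /cons_measure /pushforward preimage_set0 measure0. Qed.

Let cons_ge0 A : 0 <= cons_measure A.
Proof. exact: measure_ge0. Qed.

Let cons_sigma_additive : semi_sigma_additive cons_measure.
Proof.
move=> F mF tF mUF; rewrite /cons_measure /pushforward preimage_bigcup.
apply: measure_semi_sigma_additive.
- by move=> i; rewrite -[X in measurable X]setTI; exact: measurable_consp.
- apply/trivIsetP => /= i j _ _ ij; rewrite -preimage_setI.
  by move/trivIsetP : tF => /(_ _ _ _ _ ij) ->//; rewrite preimage_set0.
- by rewrite -preimage_bigcup -[X in measurable X]setTI; exact: measurable_consp.
Qed.

HB.instance Definition _ := isMeasure.Build _ _ _ cons_measure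
  cons0 cons_ge0 cons_sigma_additive.

Let uncons (t : n.+1.-tuple T) : T * n.-tuple T := (thead t, [tuple of behead t]).

Let measurable_uncons : measurable_fun setT uncons.
Proof.
apply/measurable_fun_pairP; split; first exact: measurable_tnth.
exact: measurable_behead.
Qed.

Let cons_sigma_finite : sigma_finite setT cons_measure.
Proof.
have /sigma_finiteP[F [FT ndF Foo]] := sigma_finiteT mu.
have /sigma_finiteP[G [GT ndG Goo]] := sigma_finiteT nu.
exists (fun i => uncons @^-1` (F i `*` G i)).
  rewrite -preimage_bigcup; apply/seteqP; split => // t _ /=.
  have [k _ Fk] : (\bigcup_k F k) (uncons t).1 by rewrite -FT.
  have [l _ Gl] : (\bigcup_k G k) (uncons t).2 by rewrite -GT.
  exists (maxn k l) => //; split.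
  - by move: Fk; exact/subsetPset/ndF/leq_maxl.
  - by move: Gl; exact/subsetPset/ndG/leq_maxr.
move=> i; have [mF Fi] := Foo i; have [mG Gi] := Goo i; split.
  rewrite -[X in measurable X]setTI; apply: measurable_uncons => //.
  exact: measurableX.
rewrite /cons_measure /pushforward -comp_preimage.
rewrite (_ : uncons \o consp = id); last first.
  by apply/funext => -[x t]; congr pair; exact/val_inj.
by rewrite preimage_id product_measure1E// lte_mul_pinfty// ge0_fin_numE.
Qed.

HB.instance Definition _ := Measure_isSigmaFinite.Build _ _ _ cons_measure
  cons_sigma_finite.

End power_measure_succ.

(* The n-fold product measure on n-tuples, whose sigma-algebra is the one *)
(* generated by the coordinates. *)
Fixpoint power_measure d (T : measurableType d) (R : realType)
    (mu : {sigma_finite_measure set T -> \bar R}) (n : nat) :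
    {sigma_finite_measure set (n.-tuple T) -> \bar R} :=
  if n is n'.+1 then cons_measure mu (power_measure mu n')
  else \d_ [tuple].

Lemma measurable_tuple_box d (T : measurableType d) n (A : 'I_n -> set T) :
  (forall i, measurable (A i)) ->
  measurable [set t : n.-tuple T | forall i, A i (tnth t i)].
Proof.
move=> mA; rewrite (_ : mkset _ = \bigcap_(i in setT) (@tnth _ T ^~ i) @^-1` A i).
  apply: fin_bigcap_measurable => // i _; rewrite -[X in measurable X]setTI.
  exact: measurable_tnth.
by apply/seteqP; split => t /= tA i //=; exact: tA.
Qed.

Lemma power_measure_box d (T : measurableType d) (R : realType)
    (mu : {sigma_finite_measure set T -> \bar R}) n (A : 'I_n -> set T) :
  (forall i, measurable (A i)) ->
  power_measure mu n [set t | forall i, A i (tnth t i)] =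
  (\prod_(i < n) mu (A i))%E.
Proof.
elim: n A => [|n IHn] A mA /=.
  by rewrite big_ord0 diracE mem_set// => -[].
rewrite big_ord_recl -IHn//= /cons_measure /pushforward -product_measure1E//.
- congr (_ _); apply/seteqP; split => -[x t] /= => [xtA|[xA tA] i].
    by split=> [|i]; [have := xtA ord0|have := xtA (lift ord0 i); rewrite tnthS].
  by case: (unliftP ord0 i) => [j ->|->]; [rewrite tnthS; exact: tA|exact: xA].
- exact: (@measurable_tuple_box _ _ _ (fun i => A (lift ord0 i))).
Qed.

(* The sigma-algebra of 'rV[R]_n generated by the n coordinates, with the *)
(* Borel sigma-algebra on R. *)
Section rV_measurable.
Context (R : realType) (n : nat).

Let coord (i : 'I_n) (x : 'rV[R]_n) : measurableTypeR R := x ord0 i.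

Definition rV_measurable : set (set 'rV[R]_n) := g_sigma_preimage coord.

Let rV_set0 : rV_measurable set0.
Proof. exact: sigma_algebra0. Qed.

Let rV_setC A : rV_measurable A -> rV_measurable (~` A).
Proof. exact: sigma_algebraC. Qed.

Let rV_bigcup (F : (set 'rV[R]_n)^nat) :
  (forall i, rV_measurable (F i)) -> rV_measurable (\bigcup_i (F i)).
Proof. exact: sigma_algebra_bigcup. Qed.

HB.instance Definition _ := @isMeasurable.Build default_measure_display
  'rV[R]_n rV_measurable rV_set0 rV_setC rV_bigcup.

End rV_measurable.


Lemma measurable_rV_coord (R : realType) n (i : 'I_n) :
  measurable_fun setT (fun x : 'rV[R]_n => x ord0 i : measurableTypeR R).
Proof.
move=> _ Y mY; rewrite setTI; apply: sub_sigma_algebra.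
by rewrite -bigcup_seq; exists i; [exact: mem_index_enum|exists Y; rewrite ?setTI].
Qed.

Section lebesgue_measure_rV.
Local Open Scope ereal_scope.
Context (R : realType) (n : nat).

Let mu : {sigma_finite_measure set (n.-tuple (measurableTypeR R)) -> \bar R} :=
  power_measure (@lebesgue_measure R) n.

Let rV_of_tuple (t : n.-tuple (measurableTypeR R)) : 'rV[R]_n :=
  \row_i tnth t i.

Definition lebesgue_measure_rV : set 'rV[R]_n -> \bar R :=
  pushforward mu rV_of_tuple.

Let measurable_rV_of_tuple : measurable_fun setT rV_of_tuple.
Proof.
apply: (@measurability _ _ _ _ _ _
  (\big[setU/set0]_(i < n) preimage_set_system setT
    (fun x : 'rV[R]_n => x ord0 i : measurableTypeR R) measurable)) => //.
move=> _ [B + <-]; rewrite -bigcup_seq => -[i _ [Y mY <-]].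
rewrite !setTI -comp_preimage.
rewrite (_ : _ \o _ = @tnth _ _ ^~ i); last first.
  by apply/funext => t /=; rewrite mxE.
by rewrite -[X in measurable X]setTI; exact: measurable_tnth.
Qed.

Let mu0 : lebesgue_measure_rV set0 = 0.
Proof. by rewrite /lebesgue_measure_rV /pushforward preimage_set0 measure0. Qed.

Let mu_ge0 A : 0 <= lebesgue_measure_rV A.
Proof. exact: measure_ge0. Qed.

Let mu_sigma_additive : semi_sigma_additive lebesgue_measure_rV.
Proof.
move=> F mF tF mUF; rewrite /lebesgue_measure_rV /pushforward preimage_bigcup.
apply: measure_semi_sigma_additive.
- by move=> i; rewrite -[X in measurable X]setTI; exact: measurable_rV_of_tuple.
- apply/trivIsetP => /= i j _ _ ij; rewrite -preimage_setI.
  by move/trivIsetP : tF => /(_ _ _ _ _ ij) ->//; rewrite preimage_set0.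
- rewrite -preimage_bigcup -[X in measurable X]setTI.
  exact: measurable_rV_of_tuple.
Qed.

HB.instance Definition _ := isMeasure.Build _ _ _ lebesgue_measure_rV
  mu0 mu_ge0 mu_sigma_additive.

Let tuple_of_rV (x : 'rV[R]_n) : n.-tuple (measurableTypeR R) :=
  [tuple x ord0 i | i < n].

Let measurable_tuple_of_rV : measurable_fun setT tuple_of_rV.
Proof.
apply/measurable_fun_tnthP => i.
rewrite (_ : _ \o _ = fun x : 'rV[R]_n => x ord0 i : measurableTypeR R).
  exact: measurable_rV_coord.
by apply/funext => x /=; rewrite tnth_mktuple.
Qed.

Let mu_sigma_finite : sigma_finite setT lebesgue_measure_rV.
Proof.
have [F FT Foo] := sigma_finiteT mu.
exists (fun i => tuple_of_rV @^-1` F i).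
  by rewrite -preimage_bigcup -FT preimage_setT.
move=> i; have [mF Fi] := Foo i; split.
  by rewrite -[X in measurable X]setTI; exact: measurable_tuple_of_rV.
rewrite /lebesgue_measure_rV /pushforward -comp_preimage.
rewrite (_ : _ \o _ = id)//; apply/funext => t /=; apply: eq_from_tnth => j.
by rewrite tnth_mktuple mxE.
Qed.

HB.instance Definition _ := Measure_isSigmaFinite.Build _ _ _
  lebesgue_measure_rV mu_sigma_finite.

End lebesgue_measure_rV.

Lemma lebesgue_measure_rV_box (R : realType) n (a b : 'I_n -> R) :
  (forall i, a i <= b i) ->
  lebesgue_measure_rV [set x : 'rV[R]_n | forall i, x ord0 i \in `[a i, b i]] =
  (\prod_(i < n) (b i - a i))%:E.
Proof.
move=> ab; rewrite -prodEFin /lebesgue_measure_rV /pushforward.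
rewrite (_ : _ @^-1` _ =
    [set t | forall i, [set` `[a i, b i]] (tnth t i)]); last first.
  by apply/seteqP; split => t /= + i => /(_ i); rewrite mxE.
transitivity (\prod_(i < n) lebesgue_measure [set` `[a i, b i]])%E.
  have box := @power_measure_box _ (measurableTypeR R) R
    (@lebesgue_measure R) n (fun i => [set` `[a i, b i]]).
  by apply: box => i; exact: measurable_itv.
apply: eq_bigr => i _.
rewrite lebesgue_measure_itv/= lte_fin; case: ltgtP (ab i) => // -> _.
by rewrite subrr.
Qed.

Definition complex_integral d (T : measurableType d) (R : realType)
    (mu : {measure set T -> \bar R}) (D : set T) (f : T -> R[i]) : R[i] :=
  (\int[mu]_(x in D) complex.Re (f x)) +i* (\int[mu]_(x in D) complex.Im (f x)).

Section fredholm.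
Context (R : realType) (nu : nat) (D : set 'rV[R]_nu).
Implicit Types (K : 'rV[R]_nu -> 'rV[R]_nu -> R[i]) (kappa : R[i]).

Definition fredholm_coef K n : R[i] :=
  complex_integral (power_measure (@lebesgue_measure_rV R nu) n)
    [set xi : n.-tuple 'rV[R]_nu | forall i, D (tnth xi i)]
    (fun xi => \det (\matrix_(i < n, j < n) K (tnth xi i) (tnth xi j))).

(* R[i] carries no canonical topology; R[i]^o has the one of the modulus. *)
Definition fredholm_det K kappa : R[i] :=
  1 + limn (fun N => \sum_(1 <= n < N)
              ((- kappa) ^+ n / n`!%:R * fredholm_coef K n) : R[i]^o).

End fredholm.

Section partial_integral_operator.
Context (R : realType) (a b : R) (nu : nat).
Let V := 'rV[R]_nu.

Definition cube : set V := [set x | forall i, x ord0 i \in `[a, b]].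

Definition cube3 : set (V * V * V) := cube `*` cube `*` cube.

Record partial_integral_operator := PartialIntegralOperator {
  pio_kernel : V -> V -> V -> R[i] ;
  pio_kernel_continuous :
    {within cube3, continuous (fun p => pio_kernel p.1.1 p.1.2 p.2 : R[i]^o)}
}.

Implicit Types (T : partial_integral_operator).

Definition pio_apply T (f : V * V -> R[i]) : V * V -> R[i] := fun p =>
  complex_integral (@lebesgue_measure_rV R nu) cube
    (fun s => pio_kernel T p.1 s p.2 * f (s, p.2)).

Coercion pio_apply : partial_integral_operator >-> Funclass.

Lemma pio_adjoint_kernel_continuous T : {within cube3, continuous
  (fun p => (pio_kernel T p.1.2 p.1.1 p.2)^* : R[i]^o)}.
Proof.
have conj_continuous : continuous (fun z : R[i]^o => (z : R[i])^* : R[i]^o).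
  move=> z A /nbhs_ballP[e /= e0 zA]; apply/nbhs_ballP; exists e => // w zw.
  apply: zA; rewrite /ball/= /ball_/=.
  suff -> : `|(z : R[i])^* - (w : R[i])^*| = `|(z : R[i]) - w| by [].
  by rewrite -rmorphB normcJ.
apply/subspace_continuousP => -[[x s] y] [[/= Dx Ds] Dy].
apply: (@cvg_comp _ _ _
  (fun p : V * V * V => pio_kernel T p.1.2 p.1.1 p.2 : R[i]^o)
  (fun z : R[i]^o => (z : R[i])^* : R[i]^o)); last exact: conj_continuous.
have /subspace_continuousP/(_ (s, x, y)) := @pio_kernel_continuous T.
move=> /(_ (conj (conj Ds Dx) Dy)) kcvg.
apply: (@cvg_comp _ _ _ (fun p : V * V * V => (p.1.2, p.1.1, p.2))
  (fun p : V * V * V => pio_kernel T p.1.1 p.1.2 p.2 : R[i]^o)); last exact: kcvg.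
have c1 : (p.1 : V * V) @[p --> nbhs (x, s, y)] --> nbhs (x, s) by exact: cvg_fst.
have c11 : p.1.1 @[p --> nbhs (x, s, y)] --> nbhs x.
  by move=> P xP; apply: (c1 (fst @^-1` P)); exact: (cvg_fst xP).
have c12 : p.1.2 @[p --> nbhs (x, s, y)] --> nbhs s.
  by move=> P sP; apply: (c1 (snd @^-1` P)); exact: (cvg_snd sP).
have c2 : p.2 @[p --> nbhs (x, s, y)] --> nbhs y by exact: cvg_snd.
have swap_cvg := cvg_pair (cvg_pair c12 c11) c2.
move=> B /swap_cvg sB.
have : \forall p \near nbhs (x, s, y), cube3 (p.1.2, p.1.1, p.2) ->
  B (p.1.2, p.1.1, p.2) by exact: sB.
by apply: filterS => -[[x' s'] y'] /= + [[/= ? ?] ?]; apply.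
Qed.

(* The L_2-adjoint of T is again a partial integral operator, with kernel *)
(* the conjugate of k(s, x, y). *)
Definition pio_adjoint T : partial_integral_operator :=
  PartialIntegralOperator (pio_kernel := fun x s y => (pio_kernel T s x y)^*)
    (@pio_adjoint_kernel_continuous T).

Definition pio_det T (y : V) (kappa : R[i]) : R[i] :=
  fredholm_det cube (fun x s => pio_kernel T x s y) kappa.

Definition singular_numbers T : set R[i] :=
  [set kappa | exists2 y0, cube y0 & pio_det T y0 kappa = 0].

(* Borel sets suffice here: every Lebesgue-measurable set of positive *)
(* measure contains a Borel set of the same measure. *)
Definition characteristic_numbers T : set R[i] :=
  [set kappa | exists Omega0 : set V,
    [/\ measurable Omega0, Omega0 `<=` cube,
        (0 < lebesgue_measure_rV Omega0)%E &
        forall y, Omega0 y -> pio_det T y kappa = 0]].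

Definition essential_numbers T : set R[i] :=
  singular_numbers T `\` characteristic_numbers T.

End partial_integral_operator.

(* Main.v *)
(* Transposing a matrix preserves its determinant and the entries of the
   adjoint's kernel are conjugated, so every coefficient of the Fredholm series
   of the adjoint at y is the conjugate of the corresponding one for T. Hence
   D_1^*(y; conj kappa) = conj D_1(y; kappa) for every y, and both determinants
   have the same zeros. *)
Require Import Defs.
From HB Require Import structures.
From mathcomp Require Import all_boot all_order all_algebra.
From mathcomp Require Import all_classical all_reals all_analysis.
From mathcomp Require Import complex.

Set Implicit Arguments.
Unset Strict Implicit.
Unset Printing Implicit Defensive.

Import Order.TTheory GRing.Theory Num.Theory.
Import numFieldNormedType.Exports.

Local Open Scope classical_set_scope.
Local Open Scope ring_scope.
Local Open Scope complex_scope.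

(* Also true for non-integrable [f]: [fine] sends infinite values to 0. *)
Lemma RintegralN d (T : measurableType d) (R : realType)
    (mu : {measure set T -> \bar R}) (D : set T) (f : T -> R) :
  \int[mu]_(x in D) - f x = - \int[mu]_(x in D) f x.
Proof.
rewrite /Rintegral -fineN [in LHS]integralE [in RHS]integralE.
rewrite (_ : (fun x => (- f x)%:E) = (\- (fun x => (f x)%:E))%E)//.
rewrite funeposN funenegN.
(* For infinite parts, [-(r - s)] and [s - r] may differ in sign, but [fine] sends both to 0. *)
by move: (integral _ _ _) (integral _ _ _) => [r||] [s||] //=; rewrite opprB.
Qed.

(** Conjugation keeps the real part and negates the imaginary one, so only a sign has to leave a
    real integral. *)
Lemma complex_integral_conj d (T : measurableType d) (R : realType)
    (mu : {measure set T -> \bar R}) (D : set T) (f : T -> R[i]) :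
  complex_integral mu D (fun x => (f x)^*) = (complex_integral mu D f)^*.
Proof.
rewrite /complex_integral /= -RintegralN.
by congr (_ +i* _); congr (Rintegral _ _ _); apply/funext => x; case: (f x).
Qed.

Section conjugation.
Context (R : realType).
Local Notation conjo := (fun z : R[i]^o => (z : R[i])^* : R[i]^o).

Lemma continuous_conjc : continuous conjo.
Proof.
move=> z A /nbhs_ballP[e /= e0 zA]; apply/nbhs_ballP; exists e => // w zw.
by apply: zA; rewrite /ball /ball_ /= -rmorphB normcJ.
Qed.

(* A divergent sequence has limit [point = 0], which is fixed by conjugation. *)
Lemma limn_conjc (u : nat -> R[i]^o) : limn (conjo \o u) = conjo (limn u).
Proof.
have cvg_conjo (v : nat -> R[i]^o) (l : R[i]^o) :
    v n @[n --> \oo] --> l -> (conjo \o v) n @[n --> \oo] --> conjo l.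
  move=> vl; exact: (cvg_comp _ _ vl (@continuous_conjc l)).
have [/cvg_conjo cu|du] := pselect (cvgn u).
  by apply: cvg_lim cu; exact: norm_hausdorff.
have -> : limn u = 0 := dvgP du.
have -> : conjo 0 = 0 := conjc0 R.
(* Conjugation is an involution: if the conjugated sequence converged, so would [u]. *)
apply: dvgP => /cvg_conjo.
have -> : conjo \o (conjo \o u) = u by apply/funext => n; exact: conjcK.
by move/cvgP.
Qed.

End conjugation.

Section fredholm_adjoint.
Context (R : realType) (nu : nat) (D : set 'rV[R]_nu).
Implicit Types K : 'rV[R]_nu -> 'rV[R]_nu -> R[i].

Lemma fredholm_coef_adjoint K n :
  fredholm_coef D (fun x s => (K s x)^*) n = (fredholm_coef D K n)^*.
Proof.
rewrite /fredholm_coef -complex_integral_conj.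
congr complex_integral; apply/funext => xi.
rewrite -(det_map_mx (@conjc R)) -det_tr.
by congr (\det _); apply/matrixP => i j; rewrite !mxE.
Qed.

(** The partial sums are conjugate term by term, as [n!] is real; [limn_conjc] carries this to the
    limit, whether or not the partial sums converge. *)
Lemma fredholm_det_adjoint K kappa :
  fredholm_det D (fun x s => (K s x)^*) kappa^* = (fredholm_det D K kappa)^*.
Proof.
rewrite /fredholm_det rmorphD rmorph1; congr (1 + _).
rewrite -[RHS]limn_conjc.
apply: (congr1 (fun u : nat -> R[i]^o => limn u)); apply/funext => N /=.
rewrite rmorph_sum; apply: eq_bigr => n _.
rewrite fredholm_coef_adjoint rmorphM; congr (_ * _).
by rewrite rmorphM rmorphXn rmorphN fmorphV rmorph_nat.
Qed.

End fredholm_adjoint.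

Section adjoint_numbers.
Context (R : realType) (a b : R) (nu : nat).
Implicit Types (T : partial_integral_operator a b nu) (kappa : R[i]).

(** An equivalence, because essential numbers also require non-zeros to be transferred. *)
Lemma pio_det_adjoint_eq0 T y kappa :
  pio_det (pio_adjoint T) y kappa^* = 0 <-> pio_det T y kappa = 0.
Proof.
rewrite /pio_det fredholm_det_adjoint.
by split => [/eqP|->]; [rewrite conjc_eq0 => /eqP|exact: conjc0].
Qed.

Lemma singular_numbers_adjoint T kappa :
  singular_numbers (pio_adjoint T) kappa^* <-> singular_numbers T kappa.
Proof.
have det_eq0 y := pio_det_adjoint_eq0 T y kappa.
split=> -[y Dy det0].
  exact: (ex_intro2 _ _ y Dy ((det_eq0 y).1 det0)).
exact: (ex_intro2 _ _ y Dy ((det_eq0 y).2 det0)).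
Qed.

(** The zeros agree for each [y], so the same set [D] is a witness on both sides. *)
Lemma characteristic_numbers_adjoint T kappa :
  characteristic_numbers (pio_adjoint T) kappa^* <->
  characteristic_numbers T kappa.
Proof.
have det_eq0 y := pio_det_adjoint_eq0 T y kappa.
split=> -[D [mD sD D0 det0]]; exists D.
  exact: (And4 mD sD D0 (fun y Dy => (det_eq0 y).1 (det0 y Dy))).
exact: (And4 mD sD D0 (fun y Dy => (det_eq0 y).2 (det0 y Dy))).
Qed.

End adjoint_numbers.

Theorem theorem2 (R : realType) (nu : nat) (a b : R)
    (k : 'rV[R]_nu -> 'rV[R]_nu -> 'rV[R]_nu -> R[i])
    (nu_ge1 : (1 <= nu)%N) (ab : a < b)
    (k_continuous : {within @cube3 R a b nu,
      continuous (fun p => k p.1.1 p.1.2 p.2 : R[i]^o)})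
    (kappa0 : R[i]) :
  let T1 := PartialIntegralOperator k_continuous in
  (essential_numbers T1 kappa0 ->
     essential_numbers (pio_adjoint T1) (kappa0^*)) /\
  (characteristic_numbers T1 kappa0 ->
     characteristic_numbers (pio_adjoint T1) (kappa0^*)).
Proof.
move=> T1; have [adj_char char_adj] := characteristic_numbers_adjoint T1 kappa0.
have [_ sing_adj] := singular_numbers_adjoint T1 kappa0.
split; last exact: char_adj.
(* Singularity passes to the adjoint; a characteristic [kappa0^*] would make [kappa0] characteristic
   for [T1], against [nchar]. *)
move=> -[sing nchar]; exact: (conj (sing_adj sing) (fun c => nchar (adj_char c))).
Qed.
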